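(* Let $K$ be a field, let $n,m\ge 1$, and let $f(X,Y)=\sum_{i=0}^{n}a_{i}Y^{i}$, $g(X,Y)=\sum_{i=0}^{m}b_{i}Y^{i}\in K[X,Y]$, with $a_{0},\dots,a_{n},b_{0},\dots,b_{m}\in K[X]$ and $a_{0}a_{n}b_{0}b_{m}\neq 0$. Assume that $f$ and $g$ have no nonconstant factors in $K[X]$. Let $k$ be a positive integer, and let $$A=\deg a_0-\max\{\deg a_1,\dots,\deg a_n\},\qquad B=\max\{\deg b_0,\dots,\deg b_{m-1}\}-\deg b_m.$$ If $\min\{A,\frac{A}{n}\}>\max\{B,\frac{B}{m}\}$ and $\min\{\deg a_0,\deg b_m\}>\delta_k$, then each one of the polynomials $f$ and $g$ is a product of at most $k$ irreducible factors in $K[X,Y]$ (counting multiplicities).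
   Context: $Res_Y(f,g)\in K[X]$ is the resultant of $f$ and $g$ regarded as polynomials in $Y$ with coefficients in $K[X]$; $\deg$ is the degree in $X$, with $\deg 0=-\infty$. For a positive integer $k$, and $f,g$ relatively prime as polynomials in $Y$ (so that $Res_Y(f,g)\neq0$), $$\delta_k=\max\left\{\deg d:\ d\in K[X],\ d\mid Res_{Y}(f,g)\ \text{and}\ \deg d\leq\frac{\deg Res_{Y}(f,g)}{k+1}\right\}.$$ The condition $\min\{A,\frac{A}{n}\}>\max\{B,\frac{B}{m}\}$ forces $f$ and $g$ to have no common root in an algebraic closure of $K(X)$, so $Res_Y(f,g)\ne 0$ and $\delta_k$ is well defined. *)

(* Defs.v *)
From HB Require Import structures.
From mathcomp Require Import all_boot all_order all_algebra.
From mathcomp Require Import boolp.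

Set Implicit Arguments.
Unset Strict Implicit.
Unset Printing Implicit Defensive.

Import Order.TTheory GRing.Theory Num.Theory.
Local Open Scope ring_scope.

(* K[X,Y] is {poly {poly K}}: the outer variable is Y, the coefficients are
   in K[X].  Beware that p %| q over the non-field {poly K} is
   pseudo-divisibility, i.e. divisibility in K(X)[Y]; hence factorizations in
   K[X,Y] are written with explicit products below. *)

(* Equals 0 rather than -oo at the zero polynomial.  This is harmless when
   taking a maximum over a family that contains a nonzero polynomial. *)
Definition deg (K : fieldType) (p : {poly K}) : nat := (size p).-1.

Definition no_nonconstant_factor_in_KX (K : fieldType)
    (f : {poly {poly K}}) : Prop :=
  forall (c : {poly K}) (h : {poly {poly K}}),
    f = c%:P * h -> (size c <= 1)%N.

(* polydiv's irreducible_poly relies on pseudo-divisibility, and so does not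
   express irreducibility in K[X,Y]. *)
Definition irreducible_elt (R : idomainType) (p : R) : Prop :=
  [/\ p != 0, p \isn't a GRing.unit &
      forall q r : R, p = q * r -> q \is a GRing.unit \/ r \is a GRing.unit].

(* The factors are listed with multiplicity; a unit in front of the product
   can be absorbed in one of them when p is not itself a unit. *)
Definition product_of_at_most (R : idomainType) (k : nat) (p : R) : Prop :=
  exists s : seq R,
    [/\ (size s <= k)%N, (forall q, q \in s -> irreducible_elt q) &
        p = \prod_(q <- s) q].

Definition delta_admissible (K : fieldType) (k : nat)
    (f g : {poly {poly K}}) (d : {poly K}) : Prop :=
  d %| resultant f g /\
  (deg d)%:R <= (deg (resultant f g))%:R / k.+1%:R :> rat.

(* Only meaningful when resultant f g != 0. The range of e loses nothing, as
   an admissible d has degree at most that of the resultant; see deltaP. *)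
Definition delta (K : fieldType) (k : nat) (f g : {poly {poly K}}) : nat :=
  \max_(e < (deg (resultant f g)).+1 |
      `[< exists2 d, delta_admissible k f g d & deg d = e >]) e.

Lemma deltaP (K : fieldType) (k : nat) (f g : {poly {poly K}}) :
  resultant f g != 0 ->
  (exists2 d, delta_admissible k f g d & deg d = delta k f g) /\
  (forall d, delta_admissible k f g d -> (deg d <= delta k f g)%N).
Proof.
move=> R0; split; last first.
  move=> d dP; have ltd : (deg d < (deg (resultant f g)).+1)%N.
    by rewrite ltnS /deg -!subn1 leq_sub2r // dvdp_leq //; case: dP.
  rewrite /delta; apply: (leq_bigmax_cond (Ordinal ltd)).
  by apply/asboolP; exists d.
rewrite /delta.
have [|i /asboolP iP ->] := @eq_bigmax_cond _
    [pred e : 'I_(deg (resultant f g)).+1 |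
      `[< exists2 d, delta_admissible k f g d & deg d = e >]] (@nat_of_ord _).
  apply/card_gt0P; exists ord0; apply/asboolP; exists 1; last first.
    by rewrite /deg size_poly1.
  by split; rewrite ?dvd1p // /deg size_poly1 divr_ge0 // ler0n.
exact: iP.
Qed.

(* Main.v *)
Require Import Defs.
From HB Require Import structures.
From mathcomp Require Import all_boot all_order all_algebra.
From mathcomp Require Import fingroup perm.
From mathcomp Require Import boolp zify ring lra.

Set Implicit Arguments.
Unset Strict Implicit.
Unset Printing Implicit Defensive.

Import Order.TTheory GRing.Theory Num.Theory.
Local Open Scope ring_scope.

(** The hypothesis on [A] and [B] gives a rational slope [r] such that, when
    [X^j Y^i] is given the weight [j + i * r], the coefficient of [Y^0] in [f]
    and the leading coefficient of [g] are strictly heavier than all the other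
    coefficients of the same polynomial.  In terms of valuations: every root of
    [f] has degree greater than [r], every root of [g] has degree less than [r].

    Being strictly dominated by the coefficient in degree 0 (resp. by the
    leading one) is inherited by factors ([dominant_atM]), as for a vertex of a
    Newton polygon.  When [f] and [g] have this shape, the diagonal of their
    Sylvester matrix dominates its determinant, whence
      deg Res(f, g) = deg_Y g * deg f_0 + deg_Y f * deg (lc g)
    ([resultant_dominant]).  In particular a factor [q] of [f] of positive
    degree in [Y] satisfies deg Res(q, g) >= deg (lc g) = deg b_m > delta.

    Suppose now that [f] is a product of more than [k] nonunits; none of them
    lies in K[X].  The resultants Res(q, g) multiply up to Res(f, g)
    ([resultantMr]), so one of them is a divisor of Res(f, g) of degree at most
    deg Res(f, g) / (k + 1), hence at most delta: a contradiction.  The argument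
    for [g] is the same, with deg Res(f, q) >= deg a_0.  Finally, a longest
    factorization into nonunits is one into irreducibles. *)

(** * Matrices whose rows are coefficient lists of polynomials *)

(** The rows are indexed by all of [nat], so that matrices cut into blocks in
    different ways have the same type and no cast is needed. *)
Definition coef_mx (R : nzSemiRingType) N (r : nat -> {poly R}) : 'M[R]_N :=
  \matrix_(i < N, j < N) (r i)`_j.

Definition sylvester_row (R : nzSemiRingType) (d : nat) (p q : {poly R}) i :=
  if (i < d)%N then 'X^i * p else 'X^(i - d) * q.

Lemma Sylvester_coef_mx (R : nzRingType) (p q : {poly R}) :
  Sylvester_mx p q =
  coef_mx ((size q).-1 + (size p).-1) (sylvester_row (size q).-1 p q).
Proof.
apply/matrixP=> i j; rewrite Sylvester_mxE mxE /sylvester_row.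
case: splitP => k iE; first by rewrite iE coefXnM ltnNge if_neg -mulrb.
by rewrite iE addKn coefXnM ltnNge if_neg -mulrb.
Qed.

(** Row [i] of the product is the combination of the polynomials [r j] with
    coefficients those of [c i].  If [c i] is supported on a range of indices
    over which [r] consists of the successive shifts of one polynomial [h],
    this combination is a product of polynomials. *)
Lemma coef_mulmx (R : comNzRingType) N (c r t : nat -> {poly R}) :
  (forall i, (i < N)%N -> exists k l p h,
     [/\ c i = 'X^k * p, (size p <= l)%N, (k + l <= N)%N,
         forall j, (j < l)%N -> r (k + j)%N = 'X^j * h & t i = p * h]) ->
  coef_mx N c *m coef_mx N r = coef_mx N t.
Proof.
move=> H; apply/matrixP=> i x; rewrite !mxE.
have [k [l [p [h [cE sp kl rE ->]]]]] := H i (ltn_ord i).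
have -> : p * h = \sum_(j < l) p`_j *: ('X^j * h).
  rewrite -[p in LHS]coefK poly_def.
  rewrite (big_ord_widen l (fun j => p`_j *: 'X^j)) //.
  rewrite big_mkcond mulr_suml; apply: eq_bigr => j _.
  case: ltnP => [_|le_j]; first by rewrite -scalerAl.
  by rewrite nth_default // scale0r mul0r.
rewrite coef_sum.
under eq_bigr => j _ do rewrite !mxE cE.
rewrite -(big_mkord xpredT (fun j => ('X^k * p)`_j * (r j)`_x)).
rewrite (@big_cat_nat _ _ _ (k + l)) //= (@big_cat_nat _ _ _ k) ?leq_addr //=.
rewrite big_nat_cond big1 ?add0r; last first.
  by move=> j /andP[/andP[_ jk] _]; rewrite coefXnM jk mul0r.
rewrite [X in _ + X]big_nat_cond [X in _ + X]big1 ?addr0; last first.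
  move=> j /andP[/andP[lj _] _].
  rewrite coefXnM ltnNge (leq_trans _ lj) ?leq_addr //=.
  rewrite nth_default ?mul0r // (leq_trans sp) // leq_subRL //.
  exact: leq_trans (leq_addr _ _) lj.
rewrite -{1}[k]add0n big_addn addKn big_mkord.
apply: eq_bigr => j _.
by rewrite addnC coefXnM ltnNge leq_addr /= addKn rE // coefZ.
Qed.

Lemma det_coef_mx_block (R : comNzRingType) k l (r : nat -> {poly R}) (c : R) :
  (forall i, (i < k)%N -> (size (r i) <= k)%N) ->
  (forall i, (i < l)%N -> (size (r (k + i)%N) <= (k + i).+1)%N) ->
  (forall i, (i < l)%N -> (r (k + i)%N)`_(k + i) = c) ->
  \det (coef_mx (k + l) r) = \det (coef_mx k r) * c ^+ l.
Proof.
move=> Hu Hs Hc.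
rewrite -[coef_mx (k + l) r]submxK.
have -> : ursubmx (coef_mx (k + l) r) = 0.
  apply/matrixP=> i j; rewrite !mxE /= nth_default //.
  by rewrite (leq_trans (Hu _ (ltn_ord i))) ?leq_addr.
rewrite det_lblock; congr (\det _ * _).
  by apply/matrixP=> i j; rewrite !mxE.
rewrite det_trig; last first.
  apply/is_trig_mxP=> i j ij; rewrite !mxE /= nth_default //.
  by rewrite (leq_trans (Hs _ _)) // -addnS leq_add2l.
rewrite (eq_bigr (fun=> c)) ?prodr_const ?card_ord // => i _.
by rewrite !mxE /= Hc.
Qed.

Lemma det_coef_mx_shift (R : comNzRingType) k l (r s : nat -> {poly R}) :
  (forall i, (i < k)%N -> r i = 'X^i) ->
  (forall i, (i < l)%N -> r (k + i)%N = 'X^k * s i) ->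
  \det (coef_mx (k + l) r) = \det (coef_mx l s).
Proof.
move=> Hu Hs.
rewrite -[coef_mx (k + l) r]submxK.
have -> : ursubmx (coef_mx (k + l) r) = 0.
  apply/matrixP=> i j; rewrite !mxE /= Hu // coefXn.
  by case: eqP => // ji; have := ltn_ord i; rewrite -ji ltnNge leq_addr.
rewrite det_lblock (_ : ulsubmx _ = 1%:M) ?det1 ?mul1r.
  congr (\det _); apply/matrixP=> i j; rewrite !mxE /=.
  rewrite (Hs _ (ltn_ord i)) coefXnM.
  by rewrite ltnNge leq_addr addKn.
by apply/matrixP=> i j; rewrite !mxE /= Hu // coefXn eq_sym.
Qed.

(** * Multiplicativity of the resultant *)

(** Put [m1], [m2] and [n] for the degrees of [p1], [p2] and [q].  Two matrix
    products are equal to the matrix with rows [X^i q] (i < m1),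
    [X^i q p1] (i < m2) and [X^i p1 p2] (i < n).  One is [U] times the Sylvester
    matrix of [q] and [p1 p2].  The other is [T1 *m T2], where [T1] is the
    Sylvester matrix of [q] and [p2] extended by an identity block, and [T2] is
    that of [q] and [p1] extended by [m2] more shifts of [p1].  Both
    [U] and the extension of [T2] contribute [lead_coef p1 ^+ m2] to the
    determinants. *)
Lemma resultantMr (R : idomainType) (q p1 p2 : {poly R}) :
  p1 != 0 -> p2 != 0 ->
  resultant q (p1 * p2) = resultant q p1 * resultant q p2.
Proof.
move=> nz1 nz2.
have [m1 sz1] : exists m1, size p1 = m1.+1.
  by exists (size p1).-1; rewrite -polySpred.
have [m2 sz2] : exists m2, size p2 = m2.+1.
  by exists (size p2).-1; rewrite -polySpred.
have sz12 : size (p1 * p2) = (m1 + m2).+1.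
  by rewrite size_mul // sz1 sz2 addSn addnS.
rewrite /resultant !Sylvester_coef_mx sz1 sz2 sz12 /=.
set n := (size q).-1; have szq : (size q <= n.+1)%N by apply: leqSpred.
have sXn (p : {poly R}) d i :
    (size p <= d.+1)%N -> (size ('X^i * p)%R <= (i + d).+1)%N.
  move=> sp; have [->|pn0] := eqVneq p 0; first by rewrite mulr0 size_poly0.
  by rewrite mulrC size_mulXn // -addnS leq_add2l.
pose U i := if (m1 <= i < m1 + m2)%N then 'X^(i - m1) * p1 else 'X^i.
pose S := sylvester_row (m1 + m2) q (p1 * p2).
pose S2 := sylvester_row m2 q p2.
pose T1 i := if (i < m1)%N then 'X^i else 'X^m1 * S2 (i - m1)%N.
pose T2 := sylvester_row m1 q p1.
pose T i := if (i < m1)%N then 'X^i * q else p1 * S2 (i - m1)%N.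
have US : coef_mx (m1 + m2 + n) U *m coef_mx (m1 + m2 + n) S
          = coef_mx (m1 + m2 + n) T.
  apply: coef_mulmx => i iN.
  rewrite /U /S /T /S2 /sylvester_row.
  case: (ltnP i m1) => [im1|m1i] /=.
    exists i, 1%N, 1, ('X^i * q); rewrite mulr1 size_poly1 mul1r.
    split => //; first lia.
    by case=> // _; rewrite addn0 (ltn_addr _ im1) expr0 mul1r.
  case: (ltnP i (m1 + m2)) => [im|mi] /=.
    exists 0%N, (m1 + m2)%N, ('X^(i - m1) * p1), q; split.
    - by rewrite expr0 mul1r.
    - by apply: leq_trans (sXn _ m1 _ _) _; rewrite ?sz1 //; lia.
    - by lia.
    - by move=> j jl; rewrite add0n jl.
    - by rewrite ltn_subLR // im mulrCA mulrA.
  exists i, 1%N, 1, ('X^(i - (m1 + m2)) * (p1 * p2)).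
  rewrite mulr1 size_poly1 mul1r.
  split => //; first lia.
    by case=> // _; rewrite addn0 ltnNge mi /= expr0 mul1r.
  have -> : (i - m1 < m2)%N = false by lia.
  by rewrite mulrCA subnDA.
have TT : coef_mx (m1 + m2 + n) T1 *m coef_mx (m1 + m2 + n) T2
          = coef_mx (m1 + m2 + n) T.
  apply: coef_mulmx => i iN.
  rewrite /T1 /T2 /T; case: (ltnP i m1) => [im1|m1i] /=.
    exists i, 1%N, 1, ('X^i * q); rewrite mulr1 size_poly1 mul1r.
    split => //; first lia.
    by case=> // _; rewrite /sylvester_row addn0 im1 expr0 mul1r.
  exists m1, (m2 + n)%N, (S2 (i - m1)%N), p1.
  split => //; last by rewrite mulrC.
  - rewrite /S2 /sylvester_row; case: ltnP => ?.
      by apply: leq_trans (sXn _ n _ _) _ => //; lia.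
    by apply: leq_trans (sXn _ m2 _ _) _; rewrite ?sz2 //; lia.
  - by rewrite addnA.
  - by move=> j jl; rewrite /sylvester_row ltnNge leq_addr addKn.
have lc1 : lead_coef p1 != 0 by rewrite lead_coef_eq0.
have dU : \det (coef_mx (m1 + m2 + n) U) = lead_coef p1 ^+ m2.
  rewrite (@det_coef_mx_block _ _ n U 1).
  - rewrite expr1n mulr1 (@det_coef_mx_block _ _ m2 U (lead_coef p1)).
    + rewrite (_ : coef_mx m1 U = 1%:M) ?det1 ?mul1r //.
      apply/matrixP=> i j; rewrite !mxE /U leqNgt ltn_ord /= coefXn.
      by rewrite eq_sym.
    + by move=> i im; rewrite /U [(m1 <= i)%N]leqNgt im /= size_polyXn.
    + move=> i im; rewrite /U leq_addr ltn_add2l im /= addKn addnC.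
      by apply: sXn; rewrite sz1.
    + move=> i im; rewrite /U leq_addr ltn_add2l im /= addKn.
      by rewrite coefXnM ltnNge leq_addl /= addnK lead_coefE sz1.
  - move=> i im; rewrite /U im andbT; case: ifP => Hi.
      by apply: leq_trans (sXn _ m1 _ _) _; rewrite ?sz1 //; lia.
    by rewrite size_polyXn.
  - by move=> i _; rewrite /U [(_ + _ < _)%N]ltnNge leq_addr andbF size_polyXn.
  - by move=> i _; rewrite /U [(_ + _ < _)%N]ltnNge leq_addr andbF coefXn eqxx.
have dT1 : \det (coef_mx (m1 + m2 + n) T1) = \det (coef_mx (m2 + n) S2).
  rewrite -addnA; apply: det_coef_mx_shift => i im; first by rewrite /T1 im.
  by rewrite /T1 ltnNge leq_addr addKn.
have dT2 : \det (coef_mx (m1 + m2 + n) T2) =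
    \det (coef_mx (m1 + n) T2) * lead_coef p1 ^+ m2.
  rewrite addnAC; apply: det_coef_mx_block => i im; rewrite /T2 /sylvester_row.
  - case: ltnP => ?; first by apply: leq_trans (sXn _ n _ _) _ => //; lia.
    by apply: leq_trans (sXn _ m1 _ _) _; rewrite ?sz1 //; lia.
  - rewrite ltnNge -addnA leq_addr addKn /=.
    by apply: leq_trans (sXn _ m1 _ _) _; rewrite ?sz1 //; lia.
  - rewrite ltnNge -addnA leq_addr addKn /= coefXnM ltnNge.
    by rewrite leq_addl /= addnK lead_coefE sz1.
have lcn : lead_coef p1 ^+ m2 != 0 by rewrite expf_neq0.
apply: (mulfI lcn); rewrite -{1}dU -/S -/S2 -/T2.
rewrite -det_mulmx US -TT det_mulmx dT1 dT2.
by rewrite mulrA mulrC; congr (_ * _); rewrite mulrC.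
Qed.

Lemma det_coef_mx_perm (R : comNzRingType) N (r : nat -> {poly R}) (s : 'S_N) :
  \det (\matrix_(i < N, j < N) (r (s i))`_j) = (-1) ^+ s * \det (coef_mx N r).
Proof.
rewrite -det_perm -det_mulmx -row_permE; congr (\det _).
by apply/matrixP=> i j; rewrite !mxE.
Qed.

(** Both Sylvester matrices have the same rows, in an order that differs by a
    rotation.  Its sign is immaterial for divisors and degrees. *)
Lemma resultantC (R : comNzRingType) (p q : {poly R}) :
  exists b : bool, resultant q p = (-1) ^+ b * resultant p q.
Proof.
rewrite /resultant !Sylvester_coef_mx.
set n := (size q).-1; set m := (size p).-1; rewrite [(m + n)%N]addnC.
have ltN (i : 'I_(n + m)) : ((if i < m then n + i else i - m) < n + m)%N.
  by have := ltn_ord i; case: (ltnP i m) => im; lia.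
pose sw i := Ordinal (ltN i).
have sw_inj : injective sw.
  move=> i j /(congr1 val) /= ij; apply: val_inj => /=.
  by move: ij (ltn_ord i) (ltn_ord j); case: (ltnP i m); case: (ltnP j m); lia.
exists (perm sw_inj : bool).
rewrite -det_coef_mx_perm; congr (\det _).
apply/matrixP=> i j; rewrite !mxE permE.
rewrite /sylvester_row /=; congr (_`__).
case: (ltnP i m) => im; first by rewrite ltnNge leq_addr addKn.
by have -> : (i - m < n)%N by have := ltn_ord i; lia.
Qed.

(** Multiplicativity makes the value an idempotent, and it is nonzero. *)
Lemma resultantr1 (R : idomainType) (q : {poly R}) : resultant q 1 = 1.
Proof.
have sz_gcd := Pdiv.Idomain.eqp_size (Pdiv.Idomain.gcdp1 q).
have nz : resultant q 1 != 0 by rewrite resultant_eq0 sz_gcd size_poly1.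
apply: (mulfI nz); rewrite -resultantMr ?oner_neq0 // !mulr1 //.
Qed.

Lemma resultant_prodr (R : idomainType) (q : {poly R}) (s : seq {poly R}) :
  (forall p, p \in s -> p != 0) ->
  resultant q (\prod_(p <- s) p) = \prod_(p <- s) resultant q p.
Proof.
elim: s => [|p s IH] nz; first by rewrite !big_nil resultantr1.
have nzs x : x \in s -> x != 0 by move=> xs; rewrite nz // inE xs orbT.
have nzp : p != 0 by rewrite nz ?mem_head.
rewrite !big_cons resultantMr ?IH //.
by rewrite prodf_seq_neq0; apply/allP => x /nzs ->.
Qed.

(** * Degrees of sums and of determinants *)

Section Deg.
Variable K : fieldType.
Implicit Types p q : {poly K}.

Lemma degM p q : p != 0 -> q != 0 -> deg (p * q) = (deg p + deg q)%N.
Proof.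
by move=> p0 q0; rewrite /deg size_mul // (polySpred p0) (polySpred q0) addnS.
Qed.

Lemma deg_prod (I : Type) (s : seq I) (F : I -> {poly K}) :
    \prod_(i <- s) F i != 0 ->
  deg (\prod_(i <- s) F i) = (\sum_(i <- s) deg (F i))%N.
Proof.
elim: s => [|i s IH]; first by rewrite !big_nil /deg size_poly1.
by rewrite !big_cons mulf_eq0 => /norP[Fi Fs]; rewrite degM // IH.
Qed.

Lemma deg_addl p q : p != 0 -> (q != 0 -> (deg q < deg p)%N) ->
  p + q != 0 /\ deg (p + q) = deg p.
Proof.
move=> p0 H; have [->|q0] := eqVneq q 0; first by rewrite addr0.
have sz : size (p + q) = size p.
  by apply: size_polyDl; rewrite (polySpred p0) (polySpred q0) ltnS; apply: H.
by rewrite /deg sz -size_poly_eq0 sz size_poly_eq0.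
Qed.

Lemma deg_add_sum (I : finType) (P : pred I) p (F : I -> {poly K}) :
    p != 0 -> (forall i, P i -> F i != 0 -> (deg (F i) < deg p)%N) ->
  p + \sum_(i | P i) F i != 0 /\ deg (p + \sum_(i | P i) F i) = deg p.
Proof.
move=> p0 H; apply: deg_addl => // S0; rewrite /deg.
suff: (size (\sum_(i | P i) F i)%R <= deg p)%N.
  by rewrite (polySpred S0).
apply: leq_trans (size_sum _ _ _) _; apply/bigmax_leqP => i Pi.
have [->|Fi0] := eqVneq (F i) 0; first by rewrite size_poly0.
by rewrite (polySpred Fi0); apply: H.
Qed.

(** In the Leibniz expansion, the potential [u] cancels along every permutation,
    as each index occurs once as a row and once as a column.  So the product
    over a permutation other than the identity has smaller degree than the
    product over the diagonal. *)
Lemma det_diag_dominant N (M : 'M[{poly K}]_N) (u : 'I_N -> rat) :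
    (forall i, M i i != 0) ->
    (forall i j, j != i -> M i j != 0 ->
       (deg (M i j))%:R + u j < (deg (M i i))%:R + u i) ->
  \det M != 0 /\ deg (\det M) = (\sum_i deg (M i i))%N.
Proof.
move=> diag0 off.
have nzP : \prod_i M i i != 0 by apply/prodf_neq0 => i _; apply: diag0.
rewrite -(deg_prod nzP) /determinant (bigD1 (1%g : 'S_N)) //=.
rewrite odd_perm1 expr0 mul1r.
under eq_bigr => i _ do rewrite perm1.
apply: deg_add_sum => // s s1; rewrite mulf_eq0 => /norP[_ nzS].
have -> : deg ((-1) ^+ s * \prod_i M i (s i)) = deg (\prod_i M i (s i)).
  rewrite /deg -signr_odd; case: odd.
    by rewrite expr1 mulN1r size_polyN.
  by rewrite expr0 mul1r.
rewrite (deg_prod nzS) (deg_prod nzP) -(ltr_nat rat) !natr_sum.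
have [i si] : exists i, s i != i.
  apply/existsP; apply: contraNT s1 => /existsPn H; apply/eqP/permP=> i.
  by rewrite perm1; apply/eqP; have := H i; rewrite negbK.
have nzsi j : M j (s j) != 0 by move/prodf_neq0: nzS => /(_ j isT).
suff: \sum_j ((deg (M j (s j)))%:R + u (s j)) < \sum_j ((deg (M j j))%:R + u j).
  rewrite !big_split /= [X in _ + X < _](reindex_inj (@perm_inj _ s^-1)) /=.
  by under [X in _ + X < _]eq_bigr => j _ do rewrite permKV; rewrite ltrD2r.
rewrite (bigD1 i) //= [ltRHS](bigD1 i) //=; apply: ltr_leD; first exact: off.
apply: ler_sum => j _; have [->//|sj] := eqVneq (s j) j.
exact/ltW/off.
Qed.

End Deg.

(** * Strictly dominant coefficients *)

Section Dominant.
Variables (K : fieldType) (r : rat).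
Implicit Types p q f g : {poly {poly K}}.

Definition weight p i : rat := (deg p`_i)%:R + i%:R * r.

(** In terms of the Newton polygon of [p]: the supporting line of slope [- r]
    meets it only at a vertex, which comes from the coefficient of index [d]. *)
Definition dominant_at p d : Prop :=
  p`_d != 0 /\ forall i, i != d -> p`_i != 0 -> weight p i < weight p d.

(** The first and last indices [lo] and [hi] at which the maximal weight [w] is
    reached are the ends of the edge of slope [- r] of the Newton polygon, which
    may be reduced to a vertex. *)
Lemma heaviest_coefs p : p != 0 ->
  exists lo hi (w : rat),
    [/\ p`_lo != 0 /\ p`_hi != 0, weight p lo = w /\ weight p hi = w,
        forall i, p`_i != 0 -> weight p i <= w &
        forall i, p`_i != 0 -> weight p i = w -> (lo <= i <= hi)%N].
Proof.
move=> p0.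
have lt_size i : p`_i != 0 -> (i < size p)%N.
  by apply: contraNT; rewrite -leqNgt => /(nth_default 0) ->.
have lcp : p`_(size p).-1 != 0 by rewrite -lead_coefE lead_coef_eq0.
pose top := Ordinal (lt_size _ lcp).
have [i0 /= pi0 maxi0] := @arg_maxP _ rat _ top (fun i => p`_i != 0)
  (fun i => weight p i) lcp.
pose P i := (p`_i != 0) && (weight p i == weight p i0).
have exP : exists i, P i by exists i0; rewrite /P pi0 /=.
have boundP i : P i -> (i <= size p)%N by move=> /andP[/lt_size/ltnW].
case: (ex_minnP exP) => lo /andP[lo0 /eqP wlo] minlo.
case: (ex_maxnP exP boundP) => hi /andP[hi0 /eqP whi] maxhi.
exists lo, hi, (weight p i0); split=> // i pi.
  exact: (maxi0 (Ordinal (lt_size _ pi))).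
by move=> /eqP wi; rewrite minlo ?maxhi // /P pi wi.
Qed.

(** No cancellation can occur in a coefficient of a product to which a single
    pair of coefficients brings the maximal weight. *)
Lemma coefM_extreme p q i j :
    p`_i != 0 -> q`_j != 0 ->
    (forall i' j', (i' + j' = i + j)%N -> i' != i ->
       p`_i' != 0 -> q`_j' != 0 ->
       weight p i' + weight q j' < weight p i + weight q j) ->
  (p * q)`_(i + j) != 0 /\ weight (p * q) (i + j) = weight p i + weight q j.
Proof.
move=> pi qj H; have iS : (i < (i + j).+1)%N by rewrite ltnS leq_addr.
have [||nz dg] := @deg_add_sum K 'I_(i + j).+1 (fun k => k != Ordinal iS)
  (p`_i * q`_j) (fun k => p`_k * q`_(i + j - k)).
- by rewrite mulf_neq0.
- move=> k ki; rewrite mulf_eq0 => /norP[pk qk]; rewrite !degM //.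
  have kS : (k + (i + j - k) = i + j)%N by rewrite subnKC // -ltnS.
  have := H k _ kS ki pk qk; rewrite -(ltr_nat rat) !natrD /weight.
  move/(congr1 (fun n => n%:R * r)): kS; rewrite /= !natrD !mulrDl; lra.
have E : (p * q)`_(i + j) = p`_i * q`_j +
   \sum_(k < (i + j).+1 | k != Ordinal iS) p`_k * q`_(i + j - k).
  by rewrite coefM (bigD1 (Ordinal iS)) //= addKn.
rewrite /weight E dg degM // !natrD; split=> //; ring.
Qed.

Lemma weightM_le p q (wp wq : rat) d :
    (forall i, p`_i != 0 -> weight p i <= wp) ->
    (forall j, q`_j != 0 -> weight q j <= wq) ->
  (p * q)`_d != 0 -> weight (p * q) d <= wp + wq.
Proof.
move=> Hp Hq; rewrite /weight -lerBrDr coefM.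
elim/big_ind: _ => [|x y IHx IHy|k _]; first by rewrite eqxx.
  have [->|x0] := eqVneq x 0; first by rewrite add0r.
  have [->|y0] := eqVneq y 0; first by rewrite addr0.
  move=> xy0; have := size_polyD x y.
  rewrite (polySpred xy0) (polySpred x0) (polySpred y0) maxnSS ltnS leq_max.
  by case/orP; rewrite -(ler_nat rat) => /le_trans; apply;
    [apply: IHx | apply: IHy].
rewrite mulf_eq0 => /norP[pk qk]; rewrite degM // natrD.
have kd : (k + (d - k) = d)%N by rewrite subnKC // -ltnS.
have := Hp _ pk; have := Hq _ qk; rewrite /weight.
move/(congr1 (fun n => n%:R * r)): kd; rewrite /= !natrD !mulrDl; lra.
Qed.

(** The maximal weight in a product is reached both at the sum of the first
    heaviest indices of the factors and at the sum of the last ones.  If only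
    one index carries it, these sums agree, and so first and last indices
    coincide in each factor. *)
Lemma dominant_atM p q d : dominant_at (p * q) d ->
  exists d1 d2, [/\ (d1 + d2 = d)%N, dominant_at p d1 & dominant_at q d2].
Proof.
move=> [pqd dom].
have /andP[p0 q0] : (p != 0) && (q != 0).
  by rewrite -negb_or -mulf_eq0; apply: contraNneq pqd => ->; rewrite coef0.
have [lo1 [hi1 [w1 [[l1 h1] [wl1 wh1] max1 ext1]]]] := heaviest_coefs p0.
have [lo2 [hi2 [w2 [[l2 h2] [wl2 wh2] max2 ext2]]]] := heaviest_coefs q0.
have only_d k : (p * q)`_k != 0 -> weight (p * q) k = w1 + w2 -> k = d.
  move=> nzk wk; apply/eqP; apply: contraTT (weightM_le max1 max2 pqd) => kd.
  by rewrite -ltNge -wk dom.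
have tie i j : p`_i != 0 -> q`_j != 0 ->
    ~ (weight p i + weight q j < w1 + w2) ->
    weight p i = w1 /\ weight q j = w2.
  by move=> pi qj; have := max1 _ pi; have := max2 _ qj; lra.
have lo_d : (lo1 + lo2)%N = d.
  have [||i j ij ii pi qj|nz wt] := @coefM_extreme p q lo1 lo2 => //.
    rewrite wl1 wl2; apply: contrapT => /(tie _ _ pi qj).
    by case=> [/(ext1 _ pi) ? /(ext2 _ qj) ?]; lia.
  by apply: only_d; rewrite // wt wl1 wl2.
have hi_d : (hi1 + hi2)%N = d.
  have [||i j ij ii pi qj|nz wt] := @coefM_extreme p q hi1 hi2 => //.
    rewrite wh1 wh2; apply: contrapT => /(tie _ _ pi qj).
    by case=> [/(ext1 _ pi) ? /(ext2 _ qj) ?]; lia.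
  by apply: only_d; rewrite // wt wh1 wh2.
have /andP[_ le1] := ext1 _ l1 wl1; have /andP[_ le2] := ext2 _ l2 wl2.
have [e1 e2] : hi1 = lo1 /\ hi2 = lo2 by lia.
exists lo1, lo2; split => //; split => // i ne nz.
  rewrite wl1 lt_neqAle max1 // andbT; apply: contraNneq ne => /(ext1 _ nz).
  by rewrite e1 -eqn_leq eq_sym.
rewrite wl2 lt_neqAle max2 // andbT; apply: contraNneq ne => /(ext2 _ nz).
by rewrite e2 -eqn_leq eq_sym.
Qed.

Lemma dominant_at0_factor p q : dominant_at (p * q) 0 -> dominant_at p 0.
Proof.
by move=> /dominant_atM[d1 [d2 [/eqP]]]; rewrite addn_eq0 => /andP[/eqP-> _].
Qed.

Lemma dominant_at_top_factor p q :
  dominant_at (p * q) (size (p * q)).-1 -> dominant_at p (size p).-1.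
Proof.
move=> /dominant_atM[d1 [d2 [dE D1 D2]]].
have le_top (h : {poly {poly K}}) d : dominant_at h d -> (d < size h)%N.
  by case=> hd _; apply: contraNT hd; rewrite -leqNgt => /(nth_default 0) ->.
have lt1 := le_top _ _ D1; have lt2 := le_top _ _ D2.
have p0 : p != 0 by rewrite -size_poly_gt0 (leq_trans _ lt1).
have q0 : q != 0 by rewrite -size_poly_gt0 (leq_trans _ lt2).
rewrite size_mul // in dE.
suff -> : (size p).-1 = d1 by [].
by move: lt1 lt2 dE; case: (size p) => // x; case: (size q) => // y; lia.
Qed.

(** With the potential [i * r], the weights say exactly that each row of the
    Sylvester matrix is strictly dominated by its diagonal entry, which is the
    constant coefficient of [f] or the leading coefficient of [g]. *)
Lemma resultant_dominant f g :
    dominant_at f 0 -> dominant_at g (size g).-1 ->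
  resultant f g != 0 /\
  deg (resultant f g) =
    ((size g).-1 * deg f`_0 + (size f).-1 * deg (lead_coef g))%N.
Proof.
move=> [f0 domf] [g0 domg]; rewrite -lead_coefE in g0.
have diag i : Sylvester_mx f g i i =
    match split i with inl _ => f`_0 | inr _ => lead_coef g end.
  rewrite Sylvester_mxE; case: splitP => k iE; rewrite iE ?subnn ?leqnn //.
  by rewrite leq_addl addnK.
have [||nz dg] := @det_diag_dominant K _ (Sylvester_mx f g) (fun i => i%:R * r).
- by move=> i; rewrite diag; case: split.
- move=> i j ij; rewrite diag Sylvester_mxE.
  have {}ij : (j != i :> nat)%N by [].
  case: splitP => k iE; rewrite iE in ij *.
    case: leqP => kj; rewrite ?mulr1n ?mulr0n ?eqxx // => nz.
    have {}ij : (j - k != 0)%N by lia.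
    have := domf _ ij nz; rewrite /weight natrB //; lra.
  case: leqP => kj; rewrite ?mulr1n ?mulr0n ?eqxx // => nz.
  have {}ij : (j - k != (size g).-1)%N.
    by apply: contraNneq ij => jk; rewrite -(subnK kj) jk.
  have := domg _ ij nz; rewrite /weight natrB // natrD -lead_coefE; lra.
split=> //; rewrite /resultant dg big_split_ord /=.
congr (_ + _)%N.
  rewrite (eq_bigr (fun=> deg f`_0)) ?sum_nat_const ?card_ord // => i _.
  by rewrite diag (unsplitK (inl i)).
rewrite (eq_bigr (fun=> deg (lead_coef g))) ?sum_nat_const ?card_ord // => i _.
by rewrite diag (unsplitK (inr i)).
Qed.

End Dominant.

(** * Counting factors *)

(** A factorization into nonunits of maximal length consists of irreducibles:
    splitting a reducible factor would give a longer one. *)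
Lemma product_of_at_most_nonunits (R : idomainType) k (p : R) :
    p != 0 -> p \isn't a GRing.unit ->
    (forall s : seq R, (forall q, q \in s -> q \isn't a GRing.unit) ->
       p = \prod_(q <- s) q -> (size s <= k)%N) ->
  product_of_at_most k p.
Proof.
move=> p0 pU bound.
pose P n := `[< exists s : seq R, [/\ size s = n,
  forall q, q \in s -> q \isn't a GRing.unit & p = \prod_(q <- s) q] >].
have exP : exists n, P n.
  exists 1%N; apply/asboolP; exists [:: p].
  split=> //; last by rewrite big_seq1.
  by move=> q; rewrite inE => /eqP->.
have boundP n : P n -> (n <= k)%N.
  by move=> /asboolP[s [<- sU ps]]; apply: bound.
case: (ex_maxnP exP boundP) => n /asboolP[s [sz sU ps]] maxn_s.
exists s; split=> //; first exact: bound.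
move=> q qs; split; last 1 first.
- move=> u v quv; apply/orP; apply: contraT; rewrite negb_or => /andP[uU vU].
  suff /maxn_s : P n.+1 by rewrite ltnn.
  have ppm := perm_to_rem qs.
  apply/asboolP; exists [:: u, v & rem q s]; split.
  + by rewrite -sz (perm_size ppm).
  + move=> x; rewrite !inE => /or3P[/eqP->//|/eqP->//|/mem_rem]; exact: sU.
  + by rewrite ps (perm_big _ ppm) /= !big_cons quv mulrA.
- apply: contraNneq p0 => q0.
  by rewrite ps (perm_big _ (perm_to_rem qs)) big_cons /= q0 mul0r.
- exact: sU.
Qed.

Section Bound.
Variable K : fieldType.
Implicit Types (f g q : {poly {poly K}}).

(** The smallest of more than [k] degrees is at most their sum divided by
    [k + 1]; as it is the degree of a divisor of the resultant, [delta] bounds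
    it. *)
Lemma exists_small_factor k f g (T : eqType) (s : seq T) (rho : T -> {poly K}) :
    resultant f g != 0 -> resultant f g %= \prod_(x <- s) rho x ->
    (k < size s)%N ->
  exists2 x, x \in s & (deg (rho x) <= delta k f g)%N.
Proof.
move=> R0 Rs ks; have [_ delta_max] := deltaP k R0.
have [/hasP[x xs dx]|/hasPn big_deg] :=
  boolP (has (fun x => deg (rho x) <= delta k f g)%N s); first by exists x.
have P0 : \prod_(x <- s) rho x != 0.
  by rewrite -size_poly_eq0 -(eqp_size Rs) size_poly_eq0.
have degR : deg (resultant f g) = (\sum_(x <- s) deg (rho x))%N.
  by rewrite -(deg_prod P0) /deg (eqp_size Rs).
have large x : x \in s -> (deg (resultant f g) < k.+1 * deg (rho x))%N.
  move=> xs; rewrite ltnNge; apply: contra (big_deg _ xs) => le_deg.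
  apply: delta_max; split.
    by rewrite (eqp_dvdr _ Rs) (perm_big _ (perm_to_rem xs)) big_cons dvdp_mulr.
  by rewrite ler_pdivlMr ?ltr0n // -natrM ler_nat mulnC.
have : (size s * (deg (resultant f g)).+1 <= k.+1 * deg (resultant f g))%N.
  rewrite {2}degR big_distrr /= -sum1_size big_distrl /=.
  rewrite big_seq [leqRHS]big_seq; apply: leq_sum => x xs.
  by rewrite mul1n large.
by rewrite leqNgt (leq_trans _ (leq_mul ks (leqnn _))) // ltn_pmul2l.
Qed.

Lemma size_gt1_factor f q h : f != 0 -> no_nonconstant_factor_in_KX f ->
  f = q * h -> q \isn't a GRing.unit -> (1 < size q)%N.
Proof.
move=> f0 fX fE qU; rewrite ltnNge; apply: contra qU => sq.
have qC := size1_polyC sq; rewrite qC in fE.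
have c0 : q`_0 != 0 by apply: contraNneq f0 => c0; rewrite fE c0 mul0r.
have sc : size q`_0 = 1%N.
  by apply/eqP; rewrite eqn_leq (fX _ _ fE) size_poly_gt0.
rewrite qC poly_unitE size_polyC c0 coefC /= poly_unitE sc eqxx /= unitfE.
by have := c0; rewrite -lead_coef_eq0 lead_coefE sc.
Qed.

Lemma eqp_resultantC f g : resultant f g %= resultant g f.
Proof.
have [b ->] := resultantC g f; case: b; rewrite ?expr1 ?expr0 ?mul1r ?eqpxx //.
by rewrite mulN1r -scaleN1r eqp_scale // oppr_eq0 oner_eq0.
Qed.

(** Common part of the arguments for [f] and for [g]: there, [p] is one of them
    and [rho q] is the resultant of [q] with the other one. *)
Lemma product_of_at_most_large_factors k f g (p : {poly {poly K}})
    (rho : {poly {poly K}} -> {poly K}) :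
    resultant f g != 0 -> (1 < size p)%N -> no_nonconstant_factor_in_KX p ->
    (forall s : seq {poly {poly K}}, (forall q, q \in s -> q != 0) ->
       p = \prod_(q <- s) q -> resultant f g %= \prod_(q <- s) rho q) ->
    (forall q h, p = q * h -> (1 < size q)%N ->
       (delta k f g < deg (rho q))%N) ->
  product_of_at_most k p.
Proof.
move=> R0 sp pX rhoM large.
have p0 : p != 0 by rewrite -size_poly_gt0 ltnW.
apply: product_of_at_most_nonunits => // [|s sU ps].
  by rewrite poly_unitE gtn_eqF.
rewrite leqNgt; apply/negP => ks.
have factor q : q \in s -> p = q * \prod_(x <- rem q s) x.
  by move=> qs; rewrite ps (perm_big _ (perm_to_rem qs)) big_cons.
have s0 q : q \in s -> q != 0.
  by move=> /factor pq; apply: contraNneq p0 => q0; rewrite pq q0 mul0r.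
have [q qs] := exists_small_factor R0 (rhoM s s0 ps) ks.
rewrite leqNgt => /negP; apply; apply: large (factor q qs) _.
exact: size_gt1_factor p0 pX (factor q qs) (sU _ qs).
Qed.

Lemma product_of_at_most_dominant0 (r : rat) k f g :
    dominant_at r f 0 -> dominant_at r g (size g).-1 ->
    (1 < size f)%N -> no_nonconstant_factor_in_KX f ->
    (delta k f g < deg (lead_coef g))%N ->
  product_of_at_most k f.
Proof.
move=> domf domg sf fX small; have [R0 _] := resultant_dominant domf domg.
apply: (@product_of_at_most_large_factors _ f g f (resultant g)) => //.
  by move=> s s0 fs; rewrite -resultant_prodr -?fs ?eqp_resultantC.
move=> q h fE sq; rewrite fE in domf.
have [_ dq] := resultant_dominant (dominant_at0_factor domf) domg.
rewrite /deg -(eqp_size (eqp_resultantC q g)) -/(deg _) dq.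
apply: leq_trans small _; rewrite (leq_trans _ (leq_addl _ _)) // leq_pmull //.
by rewrite -subn1 subn_gt0.
Qed.

Lemma product_of_at_most_dominant_top (r : rat) k f g :
    dominant_at r f 0 -> dominant_at r g (size g).-1 ->
    (1 < size g)%N -> no_nonconstant_factor_in_KX g ->
    (delta k f g < deg f`_0)%N ->
  product_of_at_most k g.
Proof.
move=> domf domg sg gX small; have [R0 _] := resultant_dominant domf domg.
apply: (@product_of_at_most_large_factors _ f g g (resultant f)) => //.
  by move=> s s0 gs; rewrite -resultant_prodr -?gs ?eqpxx.
move=> q h gE sq; rewrite gE in domg.
have [_ ->] := resultant_dominant domf (dominant_at_top_factor domg).
apply: leq_trans small _; rewrite (leq_trans _ (leq_addr _ _)) // leq_pmull //.
by rewrite -subn1 subn_gt0.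
Qed.

End Bound.

(** * The slope separating the two polynomials *)

(** The multiples of [r] are monotone in [i], so only [i = 1] and [i = n]
    matter; this is why [A] and [A / n] both occur in the hypothesis. *)
Lemma mulrn_lt_of_ends (r c : rat) i n :
  (0 < i <= n)%N -> r < c -> n%:R * r < c -> i%:R * r < c.
Proof.
move=> /andP[i0 le_in] rc nrc; have [r0|r0] := leP 0 r.
  by apply: le_lt_trans nrc; rewrite ler_wpM2r ?ler_nat.
by apply: le_lt_trans rc; rewrite ler_neMl ?ler1n ?ltW.
Qed.

Theorem theorem7p2 (K : fieldType) (n m : nat)
    (hn : (1 <= n)%N) (hm : (1 <= m)%N)
    (a b : nat -> {poly K}) (f g : {poly {poly K}})
    (hf : f = \sum_(i < n.+1) (a i)%:P * 'X^i)
    (hg : g = \sum_(i < m.+1) (b i)%:P * 'X^i)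
    (hab : a 0%N * a n * b 0%N * b m != 0)
    (hfX : no_nonconstant_factor_in_KX f)
    (hgX : no_nonconstant_factor_in_KX g)
    (k : nat) (hk : (0 < k)%N) (A B : rat)
    (hA : A = (deg (a 0%N))%:R - (\max_(1 <= i < n.+1) deg (a i))%:R)
    (hB : B = (\max_(0 <= i < m) deg (b i))%:R - (deg (b m))%:R)
    (hAB : Num.max B (B / m%:R) < Num.min A (A / n%:R))
    (hdelta : (delta k f g < minn (deg (a 0%N)) (deg (b m)))%N) :
  product_of_at_most k f /\ product_of_at_most k g.
Proof.
move: hab; rewrite !mulf_eq0 !negb_or => /andP[/andP[/andP[a0 an] b0] bm].
have polyE (c : nat -> {poly K}) d :
    \sum_(i < d.+1) (c i)%:P * 'X^i = \poly_(i < d.+1) c i.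
  by rewrite poly_def; apply: eq_bigr => i _; rewrite mul_polyC.
rewrite polyE in hf; rewrite polyE in hg.
have sf : size f = n.+1 by rewrite hf size_poly_eq.
have sg : size g = m.+1 by rewrite hg size_poly_eq.
have f0E : f`_0 = a 0%N by rewrite hf coef_poly.
have lcg : lead_coef g = b m by rewrite lead_coefE sg hg coef_poly ltnSn.
have [r /andP[lo hi]] :
    exists r, Num.max B (B / m%:R) < r < Num.min A (A / n%:R).
  by eexists; apply/andP; split;
    [exact: (midf_lt hAB).1 | exact: (midf_lt hAB).2].
move: lo hi; rewrite gt_max lt_min => /andP[Br Bmr] /andP[rA nrA].
rewrite ltr_pdivrMr ?ltr0n // mulrC in Bmr.
rewrite ltr_pdivlMr ?ltr0n // mulrC in nrA.
have domf : dominant_at r f 0.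
  split=> [|i i0]; first by rewrite f0E.
  rewrite /weight f0E hf coef_poly; case: ltnP => [lt_in _|];
    last by rewrite eqxx.
  have irA : i%:R * r < A by apply: mulrn_lt_of_ends rA nrA; rewrite lt0n i0.
  have le_max : (deg (a i) <= \max_(1 <= j < n.+1) deg (a j))%N.
    by apply: leq_bigmax_seq => //; rewrite mem_index_iota lt0n i0.
  by move: le_max irA; rewrite -(ler_nat rat) hA; lra.
have domg : dominant_at r g (size g).-1.
  rewrite sg /=; split=> [|i im]; first by rewrite hg coef_poly ltnSn.
  rewrite /weight hg !coef_poly ltnSn; case: ltnP => [lt_im _|];
    last by rewrite eqxx.
  have {}lt_im : (i < m)%N by rewrite ltn_neqAle im.
  (* The mirror image of the bound for [f]: [- r] replaces [r], and indices are
     counted from the top. *)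
  have irB : (m - i)%:R * - r < - B.
    apply: (@mulrn_lt_of_ends _ _ _ m); rewrite ?mulrN ?ltrN2 //.
    by rewrite subn_gt0 lt_im leq_subr.
  have le_max : (deg (b i) <= \max_(0 <= j < m) deg (b j))%N.
    by apply: leq_bigmax_seq => //; rewrite mem_index_iota.
  move: le_max irB; rewrite -(ler_nat rat) hB natrB 1?ltnW //; lra.
move: hdelta; rewrite leq_min -f0E -lcg => /andP[small_f small_g].
split.
- by apply: product_of_at_most_dominant0 domf domg _ hfX small_g; rewrite sf.
- by apply: product_of_at_most_dominant_top domf domg _ hgX small_f; rewrite sg.
Qed.
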